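(* Let $\mathbb{F}$ be a finite field, $V$ a finite dimensional $\mathbb{F}$-vector space and $\beta$ an alternating, symmetric or Hermitian form on $V$. Let $G_\beta:=\{g\in\mathrm{GL}(V)\mid\beta(gv,gw)=\beta(v,w)\ \forall v,w\in V\}$, let $W_1:=\{u\in V\mid\beta(u,v)=0\ \forall v\in V\}$ be the radical of $\beta$, let $W_2:=V/W_1$, let $G_2$ be the image of $G_\beta$ in $\mathrm{GL}(W_2)$, and put $m=\dim W_1$, $n=\dim W_2$. If $\mathbb{F}[W_2]^{G_2}$ has a homogeneous geometric separating set of size $n$, then $\mathbb{F}[V]^{G_\beta}$ has a homogeneous geometric separating set of size $m+n$ and $G_\beta$ acts on $V$ as a rigid reflection group.
   Context: For a finite dimensional representation $U$ of a finite group $G$ over $\mathbb{F}$, $\mathbb{F}[U]$ is the symmetric algebra on $U^*$ with the induced $G$-action, and $\mathbb{F}[U]^G$ is its ring of invariants. A subset $\{f_1,\ldots,f_s\}\subset\mathbb{F}[U]^G$ is a geometric separating set if its elements distinguish the $G$-orbits of $U\otimes_{\mathbb{F}}\overline{\mathbb{F}}$, where $\overline{\mathbb{F}}$ is the algebraic closure of $\mathbb{F}$ (i.e. any two points of $U\otimes_{\mathbb{F}}\overline{\mathbb{F}}$ in different $G$-orbits are separated by some $f_i$); it is homogeneous if its elements are homogeneous polynomials. A group $G$ acts on $V$ as a reflection group if the image of $G$ in $\mathrm{GL}(V)$ is generated by pseudoreflections (elements whose fixed space has codimension one). $G$ acts on $V$ as a rigid reflection group if every isotropy subgroup (stabiliser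 of a point) acts on $V$ as a reflection group. The map $G_\beta\to\mathrm{GL}(W_2)$ is well defined because $G_\beta$ preserves the radical $W_1$. *)

(* Defs.v *)
From HB Require Import structures.
From mathcomp Require Import all_boot all_order all_algebra all_fingroup.
From mathcomp Require Import all_field.
From mathcomp Require Import generic_quotient ring_quotient sesquilinear.
From mathcomp Require Import mpoly.

Set Implicit Arguments.
Unset Strict Implicit.
Unset Printing Implicit Defensive.

Import GRing.Theory.
Import passmx.

Local Open Scope ring_scope.

(* The quotient space V / W, on top of the quotient of the additive group of  *)
(* V by W (cosets of W) provided by ring_quotient.                            *)
Section QuotientSpace.
Variables (F : fieldType) (V : vectType F) (W : {vspace V}).
Local Open Scope quotient_scope.

Definition quotv := Quotient.quot W.

HB.instance Definition _ := GRing.Zmodule.on quotv.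

Implicit Types (x y : quotv) (u v : V).

Definition piv v : quotv := \pi_(Quotient.quot W) v.

Lemma piv_repr x : piv (repr x) = x.
Proof. by rewrite /piv reprK. Qed.

Lemma pivE u v : (piv u == piv v) = (u - v \in W).
Proof. by rewrite /piv -Quotient.idealrBE. Qed.

Lemma pivD : {morph piv : u v / u + v}.
Proof. by move=> u v; rewrite /piv Quotient.pi_add. Qed.

Definition scaleq (a : F) x : quotv := piv (a *: repr x).

Lemma piv_scaleq a v : scaleq a (piv v) = piv (a *: v).
Proof.
by apply/eqP; rewrite pivE -scalerBr memvZ // -pivE piv_repr.
Qed.

Lemma scaleqA a b x : scaleq a (scaleq b x) = scaleq (a * b) x.
Proof. by rewrite -(piv_repr x) !piv_scaleq scalerA. Qed.
Lemma scale1q : left_id 1 scaleq.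
Proof. by move=> x; rewrite -(piv_repr x) piv_scaleq scale1r. Qed.
Lemma scaleqDr : right_distributive scaleq +%R.
Proof.
move=> a x y; rewrite -(piv_repr x) -(piv_repr y) -pivD !piv_scaleq.
by rewrite scalerDr pivD.
Qed.
Lemma scaleqDl x : {morph scaleq^~ x : a b / a + b}.
Proof. by move=> a b; rewrite -(piv_repr x) !piv_scaleq scalerDl pivD. Qed.

HB.instance Definition _ :=
  GRing.Zmodule_isLmodule.Build F quotv scaleqA scale1q scaleqDr scaleqDl.

Lemma piv_is_linear : linear piv.
Proof. by move=> a u v; rewrite pivD -piv_scaleq. Qed.
HB.instance Definition _ :=
  GRing.isSemilinear.Build F V quotv _ piv (GRing.semilinear_linear piv_is_linear).

Let C := (W^C)%VS.
Let p : 'End(V) := daddv_pi C W.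

Let CW0 : (C :&: W = 0)%VS.
Proof. by rewrite capvC capv_compl. Qed.

Let p_piv v : piv (p v) = piv v.
Proof.
apply/eqP; rewrite eq_sym pivE.
have vCW : v \in (C + W)%VS by rewrite addvC addv_complf memvf.
by rewrite -{1}(daddv_pi_add CW0 vCW) addrC addKr memv_pi.
Qed.

Let p_eq u v : piv u = piv v -> p u = p v.
Proof.
move=> euv; apply/eqP; rewrite -subr_eq0 -memv0 -CW0 memv_cap.
by rewrite rpredB ?memv_pi //= -pivE !p_piv euv.
Qed.

Let q2r x : 'rV[F]_(\dim C) := \row_i coord (vbasis C) i (p (repr x)).

Let q2r_piv v : q2r (piv v) = \row_i coord (vbasis C) i (p v).
Proof.
by apply/rowP=> i; rewrite !mxE (@p_eq (repr (piv v)) v) // piv_repr.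
Qed.

Fact quotv_vector_axiom : Vector.axiom (\dim C) quotv.
Proof.
exists q2r => [a x y|].
  rewrite -(piv_repr x) -(piv_repr y) -linearP !q2r_piv.
  by apply/rowP=> i; rewrite !mxE !linearP.
exists (fun r : 'rV_(\dim C) => piv (\sum_i r 0 i *: (vbasis C)`_i)).
  move=> x; rewrite -[RHS]piv_repr -[RHS]p_piv; congr piv.
  rewrite [RHS](coord_vbasis (memv_pi C W _)).
  by apply: eq_bigr => i _; rewrite mxE.
move=> r; rewrite q2r_piv; apply/rowP=> i; rewrite mxE.
rewrite daddv_pi_id //.
  by rewrite coord_sum_free // (basis_free (vbasisP C)).
by apply: rpred_sum => j _; rewrite rpredZ // vbasis_mem // mem_nth ?size_tuple.
Qed.
HB.instance Definition _ :=
  Lmodule_hasFinDim.Build F quotv quotv_vector_axiom.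

Definition projq : 'Hom(V, quotv) := linfun piv.

Lemma lker_projq : lker projq = W.
Proof.
by apply/vspaceP=> v; rewrite memv_ker lfunE /= -(linear0 piv) pivE subr0.
Qed.

Lemma limg_projq : limg projq = fullv.
Proof.
apply/vspaceP=> x; rewrite memvf -(piv_repr x).
by apply/memv_imgP; exists (repr x); rewrite ?memvf ?lfunE.
Qed.

End QuotientSpace.

(* GL(V) for V over a finite field, with composition as group law. *)
Section GeneralLinear.
Variables (F : finFieldType) (V : vectType F).

Record GL := GLelt { GLfun :> 'End(V); _ : lker GLfun == 0%VS }.

HB.instance Definition _ := [isSub for GLfun].
HB.instance Definition _ := [Choice of GL by <:].

Let GLinj (g : GL) : finvect_type 'End(V) := GLfun g.
Let GLinjK : pcancel GLinj insub.
Proof. exact: valK. Qed.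
HB.instance Definition _ := isCountable.Build GL (pcan_pickleK GLinjK).
HB.instance Definition _ := isFinite.Build GL (pcan_enumP GLinjK).

Lemma lkerGL (g : GL) : lker g == 0%VS. Proof. by case: g. Qed.

Fact GL1_subproof : lker (\1%VF : 'End(V)) == 0%VS.
Proof. by apply/lker0P=> u v; rewrite !lfunE. Qed.
Fact GLM_subproof (g h : GL) : lker (g \o h)%VF == 0%VS.
Proof.
apply/lker0P=> u v; rewrite !lfunE /=.
by move/(lker0P (lkerGL g))/(lker0P (lkerGL h)).
Qed.
Fact GLV_subproof (g : GL) : lker (g^-1)%VF == 0%VS.
Proof.
apply/lker0P=> u v e.
by rewrite -(lker0_lfunVK (lkerGL g) u) e lker0_lfunVK ?lkerGL.
Qed.

Definition GL1 := GLelt GL1_subproof.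
Definition GLM g h := GLelt (GLM_subproof g h).
Definition GLV g := GLelt (GLV_subproof g).

Fact GLMA : associative GLM.
Proof. by move=> f g h; apply: val_inj; rewrite /= comp_lfunA. Qed.
Fact GL1M : left_id GL1 GLM.
Proof. by move=> g; apply: val_inj; rewrite /= comp_lfun1l. Qed.
Fact GLVM : left_inverse GL1 GLV GLM.
Proof. by move=> g; apply: val_inj; rewrite /= lker0_compVf ?lkerGL. Qed.

HB.instance Definition _ := Finite_isGroup.Build GL GLMA GL1M GLVM.

Lemma GL1E v : (1%g : GL) v = v. Proof. exact: id_lfunE. Qed.
Lemma GLME (g h : GL) v : (g * h)%g v = g (h v). Proof. exact: comp_lfunE. Qed.
Lemma GLVE (g : GL) : GLfun g^-1%g = (g^-1)%VF. Proof. by []. Qed.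

End GeneralLinear.

Section Forms.
Variables (F : finFieldType) (V : vectType F).
Implicit Types (beta : V -> V -> F) (theta : {rmorphism F -> F}).

Definition alternating_form beta :=
  bilinear_for *%R *%R beta /\ forall v, beta v v = 0.

Definition symm_form beta :=
  bilinear_for *%R *%R beta /\ forall v w, beta v w = beta w v.

(* theta is the automorphism of order two of F. *)
Definition hermitian_form beta :=
  exists theta, [/\ involutive theta, ~ theta =1 id,
    bilinear_for *%R (theta \; *%R) beta
    & forall v w, beta v w = theta (beta w v)].

Definition isoms beta : {set GL V} :=
  [set g : GL V | [forall v : finvect_type V, forall w : finvect_type V,
     beta (g v) (g w) == beta v w]].

Lemma isomsP beta (g : GL V) :
  reflect (forall v w, beta (g v) (g w) = beta v w) (g \in isoms beta).
Proof.
rewrite inE; apply: (iffP forallP) => [H v w | H v].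
  by have /forallP/(_ w)/eqP := H v.
by apply/forallP=> w; rewrite H.
Qed.

Lemma isoms_group_set beta : group_set (isoms beta).
Proof.
apply/group_setP; split=> [|g h /isomsP Hg /isomsP Hh]; apply/isomsP=> v w.
  by rewrite !GL1E.
by rewrite !GLME Hg Hh.
Qed.
Canonical isoms_group beta := Group (isoms_group_set beta).

(* The radical { u | forall v, beta u v = 0 }; linfun needs beta to be linear *)
(* in its first argument, which holds for the three kinds of forms above.     *)
Definition radical beta : {vspace V} :=
  (\bigcap_(v : finvect_type V)
     lker (linfun (fun u : V => beta u v : F^o)))%VS.

Lemma radicalP beta u : (forall v, linear_for *%R (beta^~ v)) ->
  reflect (forall v, beta u v = 0) (u \in radical beta).
Proof.
move=> lin_beta.
have kerE v : (u \in lker (linfun (fun u : V => beta u v : F^o)))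
    = (beta u v == 0).
  pose f : V -> F^o := beta^~ v.
  pose fL := GRing.isSemilinear.Build F V F^o _ f
    (GRing.semilinear_linear (lin_beta v)).
  pose fl : {linear V -> F^o} := HB.pack f fL.
  by rewrite memv_ker (lfunE fl).
apply: (iffP idP) => [/subv_bigcapP H v | H].
  by apply/eqP; rewrite -kerE memvE; apply: (H v).
by apply/subv_bigcapP=> v _; rewrite -memvE kerE H.
Qed.

End Forms.

(* The image in GL(V / W) of a set G of elements of GL(V) preserving W: those *)
(* h that are induced by some g in G.                                         *)
Definition quot_image (F : finFieldType) (V : vectType F) (W : {vspace V})
    (G : {set GL V}) : {set GL (quotv W)} :=
  [set h | [exists g in G, GLfun h \o projq W == projq W \o GLfun g]%VF].

(* Coordinates on U are taken with respect to the basis vbasis {:U}: F[U] is  *)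
(* identified with {mpoly F[\dim {:U}]}, 'X_i being the i-th coordinate       *)
(* function, and the scalar extension of U along iota : F -> K with row       *)
(* vectors over K, on which g acts through its matrix.                        *)
Section Separation.
Variables (F : finFieldType) (U : vectType F).
Implicit Types (g : GL U) (G : {set GL U}).

Definition GLmx g : 'M[F]_(\dim {:U}) := mxof (vbasis {:U}) (vbasis {:U}) g.

(* (g . f)(u) = f (g^-1 u) *)
Definition poly_act g (f : {mpoly F[\dim {:U}]}) : {mpoly F[\dim {:U}]} :=
  f \mPo [tuple \sum_j GLmx g^-1%g j i *: 'X_j | i < \dim {:U}].

Definition invariant_poly G (f : {mpoly F[\dim {:U}]}) :=
  forall g, g \in G -> poly_act g f = f.

Variables (K : closedFieldType) (iota : {rmorphism F -> K}).
Implicit Types (x y : 'rV[K]_(\dim {:U})).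

Definition point_act g x := x *m map_mx iota (GLmx g).

Definition same_orbit G x y := exists2 g, g \in G & y = point_act g x.

Definition eval_at (f : {mpoly F[\dim {:U}]}) x : K :=
  (map_mpoly iota f).@[fun i => x 0 i].

Definition geometric_separating_set G (S : seq {mpoly F[\dim {:U}]}) :=
  (forall f, f \in S -> invariant_poly G f) /\
  (forall x y, ~ same_orbit G x y ->
     exists2 f, f \in S & eval_at f x != eval_at f y).

Definition has_homog_geom_sep_set G (s : nat) :=
  exists S : seq {mpoly F[\dim {:U}]},
    [/\ uniq S, size S = s, {in S, forall f, f \is homog mdeg}
      & geometric_separating_set G S].

End Separation.

Section Reflections.
Variables (F : finFieldType) (V : vectType F).
Implicit Types (g : GL V) (G : {set GL V}).

Definition pseudoreflection g := (\dim (fixedSpace g)).+1 == \dim {:V}.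

Definition reflection_group G :=
  exists2 S : {set GL V}, {in S, forall s, pseudoreflection s} & G = <<S>>%g.

Definition isotropy G (v : V) : {set GL V} := [set g in G | g v == v].

Definition rigid_reflection_group G :=
  forall v : V, reflection_group (isotropy G v).

End Reflections.

(* Main.v *)
(** The separating set of [F[V]^G]. Every [g] in [GL V] preserving [W1] and
    acting trivially on [V / W1] lies in [G].  Besides the pullbacks of the
    given [n] separators, take the coefficients of [X^(q^i)], [n <= i < m + n],
    in the Dickson polynomial [prod_(a in V^* ) (X - a)].  At a point [x] this
    becomes an additive polynomial, whose only nonzero coefficients are those
    of the [X^(q^i)].  If [x] and [y] have the same image modulo [W1], their
    two polynomials are divisible by the product over [a in (V / W1)^*], which
    has degree [q^n]; so they are equal as soon as the chosen coefficients
    agree.  Then the evaluation maps [V^* -> Fbar] at [x] and [y] have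
    fibers of equal size, and one is carried to the other by an element of
    [GL(V^* )] fixing [(V / W1)^*], built one basis vector at a time.

    Rigidity follows the pattern of the Cartan-Dieudonne theorem.  Let [g] in [G] fix [v].  As long as some
    product [h] of pseudoreflections of the isotropy group gives [h g] a
    larger fixed space than [g], induct.  Otherwise [beta x (g x - x) = 0]
    for all [x] and the image of [g - 1] meets the radical trivially.  This
    forces [g = 1] for a Hermitian form; for an alternating form, or in
    characteristic 2, composing with a transvection along [g y - y] allows
    progress; for a symmetric form in odd characteristic a Siegel
    transformation, product of four reflections fixing [v], does. *)
From HB Require Import structures.
Require Import Defs.
From mathcomp Require Import all_boot all_order all_algebra all_fingroup.
From mathcomp Require Import all_solvable all_field.
From mathcomp Require Import sesquilinear mpoly ring.

Set Implicit Arguments.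
Unset Strict Implicit.
Unset Printing Implicit Defensive.

Import GRing.Theory.
Import passmx.
Local Open Scope ring_scope.

(** * Pseudoreflections and isotropy groups of reflexive forms *)

Section RankOne.
Variables (F : finFieldType) (V : vectType F).
Implicit Types (phi : 'Hom(V, F^o)) (w v : V) (A : {vspace V}).

Definition rank1_fun phi w v : V := v + (phi v : F) *: w.

Fact rank1_fun_linear phi w : linear (rank1_fun phi w).
Proof.
move=> c u v; rewrite /rank1_fun linearP scalerDl -scalerA scalerDr.
by rewrite addrACA.
Qed.
HB.instance Definition _ phi w := GRing.isSemilinear.Build F V V _
  (rank1_fun phi w) (GRing.semilinear_linear (rank1_fun_linear phi w)).

Definition rank1 phi w : 'End(V) := linfun (rank1_fun phi w).

Lemma rank1E phi w v : rank1 phi w v = v + (phi v : F) *: w.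
Proof. by rewrite lfunE. Qed.

(** The scalar [1 + phi w] is the determinant of [rank1 phi w]. *)
Lemma lker_rank1 phi w : 1 + phi w != 0 -> lker (rank1 phi w) == 0%VS.
Proof.
move=> nz; rewrite -subv0; apply/subvP=> v; rewrite memv_ker rank1E memv0 => /eqP e.
have : phi (v + phi v *: w) = 0 by rewrite e linear0.
rewrite linearD linearZ /= -[X in X + _]mulr1 -mulrDr => /eqP.
rewrite mulf_eq0 (negPf nz) orbF => /eqP pv0.
by rewrite pv0 scale0r addr0 in e; rewrite e.
Qed.

Lemma rank1_id_or_pseudoreflection phi w (s : GL V) :
  GLfun s = rank1 phi w -> s = 1%g \/ pseudoreflection s.
Proof.
move=> es.
have [w0|w0] := eqVneq w 0.
  left; apply: val_inj; apply/lfunP=> v.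
  by rewrite /= es rank1E w0 scaler0 addr0 lfunE.
have [p0|p0] := eqVneq phi 0.
  left; apply: val_inj; apply/lfunP=> v.
  by rewrite /= es rank1E p0 lfunE /= scale0r addr0 lfunE.
right; rewrite /pseudoreflection.
have -> : fixedSpace s = lker phi.
  apply/vspaceP=> v; rewrite memv_ker; apply/fixedSpaceP/eqP; rewrite es rank1E.
    by move/eqP; rewrite -subr_eq0 addrC addKr scaler_eq0 (negPf w0) orbF => /eqP.
  by move->; rewrite scale0r addr0.
rewrite -(limg_ker_dim phi fullv) capfv -addn1 eqn_add2l eqn_leq lt0n dimv_eq0.
apply/andP; split.
  apply: contraNneq p0 => im0; apply/eqP/lfunP=> v; rewrite lfunE /=.
  by apply/eqP; rewrite -memv0 -im0 memv_img ?memvf.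
apply: leq_trans (dimvS (subvf _)) _.
by rewrite dimvf.
Qed.

Lemma linear_separate (A : {vspace V}) (a : V) : a \notin A ->
  exists phi, {in A, forall u, phi u = 0} /\ phi a = 1.
Proof.
move=> aA; pose w := a - projv A a; have w0 : w != 0.
  by apply: contraNneq aA => /eqP; rewrite subr_eq0 => /eqP->; apply: memv_proj.
pose e := vbasis {:V}.
have [i ci] : exists i, coord e i w != 0.
  apply/existsP; apply: contra_neqT w0 => /existsPn c0.
  rewrite (coord_vbasis (memvf w)) big1 // => i _.
  by have /negbNE/eqP-> := c0 i; rewrite scale0r.
pose psi : 'Hom(V, F^o) := linfun (coord e i : V -> F^o).
exists ((coord e i w)^-1 *: (psi \o (\1 - projv A)))%VF.
have E u : ((coord e i w)^-1 *: (psi \o (\1 - projv A)))%VF u =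
    (coord e i w)^-1 * coord e i (u - projv A u).
  by rewrite scale_lfunE comp_lfunE add_lfunE opp_lfunE id_lfunE lfunE.
split=> [u uA|]; rewrite E; first by rewrite projv_id // subrr linear0 mulr0.
exact: mulVf.
Qed.

(** Two proper subspaces do not cover the space of functionals vanishing on [A]: up to scaling, one
    of [phi], [psi], [phi + psi] is nonzero at both [a] and [b]. *)
Lemma linear_separate2 (A : {vspace V}) (a b : V) : a \notin A -> b \notin A ->
  exists phi, [/\ {in A, forall u, phi u = 0}, phi a = 1 & phi b != 0].
Proof.
move=> aA bA.
have [phi [pA pa]] := linear_separate aA.
have [pb|] := eqVneq (phi b) 0; last by exists phi.
have [psi [qA qb]] := linear_separate bA.
have [qa|qa] := eqVneq (psi a) 0.
  exists (phi + psi); split=> [u uA||].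
  - by rewrite add_lfunE pA ?qA ?addr0.
  - by rewrite add_lfunE pa qa addr0.
  by rewrite add_lfunE pb qb add0r oner_eq0.
exists ((psi a)^-1 *: psi); split=> [u uA||].
- by rewrite scale_lfunE (qA u uA) scaler0.
- by rewrite scale_lfunE; apply: mulVf.
by rewrite scale_lfunE qb scaler_eq0 invr_eq0 (negPf qa) oner_eq0.
Qed.

(** When [phi a = 1], the map [rank1 phi (b - a)] has determinant [phi b], whence the need for a
    functional that is nonzero at [b] too. *)
Lemma rank1_move (A : {vspace V}) (a b : V) : a \notin A -> b \notin A ->
  exists s : GL V, [/\ {in A, forall u, s u = u}, s a = b
    & exists phi, GLfun s = rank1 phi (b - a)].
Proof.
move=> aA bA; have [phi [pA pa pb]] := linear_separate2 aA bA.
have nz : 1 + phi (b - a) != 0 by rewrite linearB /= pa addrC subrK.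
exists (GLelt (lker_rank1 nz)); split; last by exists phi.
  by move=> u uA /=; rewrite rank1E pA // scale0r addr0.
by rewrite /= rank1E pa scale1r addrC subrK.
Qed.

Lemma ker_sub_scalar (phi psi : 'Hom(V, F^o)) :
    (forall u, phi u = 0 -> psi u = 0) ->
  exists c : F, forall u, psi u = c * (phi u : F) :> F.
Proof.
move=> sub.
have [/existsP[p pp]|/existsPn phi0] := boolP [exists p : finvect_type V, phi p != 0].
  exists ((psi p : F) / phi p) => u.
  have /sub : phi (u - ((phi u : F) / phi p) *: p) = 0.
    by rewrite linearB linearZ /=; apply/eqP; rewrite subr_eq0 [_ *: _]mulfVK.
  rewrite linearB linearZ /= => /eqP; rewrite subr_eq0 => /eqP->.
  by rewrite [LHS]mulrAC [RHS]mulrAC; congr (_ / _); apply: mulrC.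
by exists 0 => u; rewrite mul0r; apply: sub; have /negbNE/eqP := phi0 u.
Qed.

(** If some [p] has [phi1 p = 0] and [phi2 p != 0], subtracting a multiple of [phi2] from [psi]
    reduces to [ker_sub_scalar]; otherwise [phi1] alone suffices. *)
Lemma ker_cap_sub_comb (phi1 phi2 psi : 'Hom(V, F^o)) :
    (forall u, phi1 u = 0 -> phi2 u = 0 -> psi u = 0) ->
  exists c1 c2 : F, forall u, psi u = c1 * (phi1 u : F) + c2 * (phi2 u : F) :> F.
Proof.
move=> sub.
have [/existsP[p /andP[/eqP p1 p2]]|/existsPn H] :=
  boolP [exists p : finvect_type V, (phi1 p == 0) && (phi2 p != 0)].
  pose c2 : F := (psi p : F) / phi2 p.
  have [u u1|c1 Hc] := @ker_sub_scalar phi1 (psi - c2 *: phi2).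
    have : psi (u - ((phi2 u : F) / phi2 p) *: p) = 0.
      apply: sub; rewrite linearB linearZ /= ?p1 ?u1 ?scaler0 ?subr0 //.
      by apply/eqP; rewrite subr_eq0 [_ *: _]mulfVK.
    rewrite linearB linearZ /= add_lfunE opp_lfunE scale_lfunE => /eqP.
    rewrite subr_eq0 => /eqP->; rewrite /c2 /GRing.scale /=.
    by apply/eqP; rewrite subr_eq0; apply/eqP; ring.
  exists c1, c2 => u; rewrite -Hc add_lfunE opp_lfunE scale_lfunE.
  by rewrite [RHS]subrK.
have [u u1|c Hc] := @ker_sub_scalar phi1 psi.
  by apply: sub => //; apply/eqP; have := H u; rewrite u1 eqxx negbK.
by exists c, 0 => u; rewrite mul0r addr0.
Qed.
End RankOne.

(** * Reflexive forms and pseudoreflections fixing a vector *)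

Section Reflexive.
Variables (F : finFieldType) (V : vectType F) (beta : V -> V -> F).
Variables (theta : {rmorphism F -> F}) (eps : F).
Hypothesis linear_left : forall w, linear_for *%R (beta^~ w).
Hypothesis semilinear_right : forall u, linear_for (theta \; *%R) (beta u).
Hypothesis eps_neq0 : eps != 0.
Hypothesis betaC : forall u w, beta u w = eps * theta (beta w u).

Lemma formDl u1 u2 w : beta (u1 + u2) w = beta u1 w + beta u2 w.
Proof. by have := linear_left w 1 u1 u2; rewrite scale1r mul1r. Qed.
Lemma form0l w : beta 0 w = 0.
Proof. by apply: (addrI (beta 0 w)); rewrite -formDl !addr0. Qed.
Lemma formZl c u w : beta (c *: u) w = c * beta u w.
Proof. by have := linear_left w c u 0; rewrite addr0 /= form0l addr0. Qed.
Lemma formNl u w : beta (- u) w = - beta u w.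
Proof. by rewrite -scaleN1r formZl mulN1r. Qed.
Lemma formDr u w1 w2 : beta u (w1 + w2) = beta u w1 + beta u w2.
Proof.
by have := semilinear_right u 1 w1 w2; rewrite scale1r /= rmorph1 mul1r.
Qed.
Lemma form0r u : beta u 0 = 0.
Proof. by apply: (addrI (beta u 0)); rewrite -formDr !addr0. Qed.
Lemma formZr c u w : beta u (c *: w) = theta c * beta u w.
Proof. by have := semilinear_right u c w 0; rewrite addr0 /= form0r addr0. Qed.
Lemma formNr u w : beta u (- w) = - beta u w.
Proof. by rewrite -scaleN1r formZr rmorphN1 mulN1r. Qed.
Definition formE := (formDl, formDr, formNl, formNr, formZl, formZr).

Lemma form_eq0C u w : (beta u w == 0) = (beta w u == 0).
Proof. by rewrite betaC mulf_eq0 (negPf eps_neq0) fmorph_eq0. Qed.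

Definition form_hom (a : V) : 'Hom(V, F^o) := linfun (fun u : V => beta u a : F^o).

Lemma form_homE a u : form_hom a u = beta u a.
Proof.
pose f : V -> F^o := beta^~ a.
pose fL := GRing.isSemilinear.Build F V F^o _ f
  (GRing.semilinear_linear (linear_left a)).
pose fl : {linear V -> F^o} := HB.pack f fL.
exact: (lfunE fl).
Qed.

Lemma mem_radicalr u w : w \in radical beta -> beta u w = 0.
Proof.
by move/(radicalP w linear_left)/(_ u)/eqP; rewrite form_eq0C => /eqP.
Qed.

Lemma isoms_mod_radical (g : GL V) :
  (forall u, g u - u \in radical beta) -> g \in isoms beta.
Proof.
move=> H; apply/isomsP=> u w.
rewrite -[g u](subrK u) -[g w](subrK w) formDl.
rewrite (radicalP _ linear_left (H u)) add0r formDr.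
by rewrite (mem_radicalr _ (H w)) add0r.
Qed.

Variable v : V.

Definition isotropy_reflections : {set GL V} :=
  [set s in isotropy (isoms beta) v | pseudoreflection s].

Local Notation H := <<isotropy_reflections>>%g.

Lemma gen_reflections_sub : H \subset isoms beta.
Proof. by rewrite gen_subG; apply/subsetP=> s; rewrite !inE -andbA => /andP[]. Qed.

Lemma gen_reflections_fix s : s \in H -> s v = v.
Proof.
pose K := [set s : GL V | s v == v].
have gK : group_set K.
  apply/group_setP; split=> [|x y]; rewrite !inE ?GL1E // => /eqP ex /eqP ey.
  by rewrite GLME ey ex.
have /subsetP sHK : H \subset Group gK.
  by rewrite gen_subG; apply/subsetP=> x; rewrite !inE => /andP[/andP[]].
by move/sHK; rewrite inE => /eqP.
Qed.

Lemma rank1_gen_reflections (s : GL V) phi w :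
  GLfun s = rank1 phi w -> s \in isoms beta -> s v = v -> s \in H.
Proof.
move=> es sG sv; have [->|ps] := rank1_id_or_pseudoreflection es.
  exact: group1.
by rewrite mem_gen // inE ps andbT inE sG sv eqxx.
Qed.

Lemma scaled_form_homE c a u : (c *: form_hom a)%VF u = c * beta u a.
Proof. by rewrite scale_lfunE form_homE. Qed.

(** The map sends [u] to [u - (beta u a / beta y a) *: a], where [a = y - x]. Dividing by [beta y a]
    instead of [beta a a] covers every characteristic and also isotropic [a], where the map is a
    transvection. *)
Lemma reflection_move (x y : V) :
    beta x x = beta y y -> beta y (y - x) != 0 -> beta v (y - x) = 0 ->
  exists s : GL V, [/\ s \in H, s y = x &
    forall e, beta e (y - x) = 0 -> s e = e].
Proof.
move=> exy; set a := y - x => nz va.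
have nz' : beta a y != 0 by rewrite form_eq0C.
have exa : beta x a = - beta a y by rewrite /a !formE exy; ring.
have ya : y - a = x by rewrite opprB addrC subrK.
pose phi := (- (beta y a)^-1 *: form_hom a)%VF.
have phiE u : phi u = - (beta y a)^-1 * beta u a by apply: scaled_form_homE.
have eaa : beta a a = beta y a + beta a y by rewrite {1}/a formDl formNl exa; ring.
clearbody a.
have k0 : 1 + phi a != 0.
  have -> : 1 + phi a = - (beta a y / beta y a).
    by rewrite phiE eaa; field.
  by rewrite oppr_eq0 mulf_neq0 ?invr_neq0.
exists (GLelt (lker_rank1 k0)).
have fixs e : beta e a = 0 -> rank1 phi a e = e.
  by move=> ea; rewrite rank1E phiE ea mulr0 scale0r addr0.
split; last by move=> e; apply: fixs.
- apply: (rank1_gen_reflections (phi := phi) (w := a)) => //; last exact: fixs.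
  apply/isomsP=> u w /=; rewrite !rank1E !phiE !formE.
  have E z : theta (beta z a) = eps^-1 * beta a z by rewrite [in RHS]betaC mulKf.
  by rewrite !rmorphM rmorphN fmorphV /= !E eaa; field; rewrite nz nz' eps_neq0.
- by rewrite /= rank1E phiE mulNr mulVf // scaleN1r.
Qed.

(** Vectors fixed by the isometry [g] are orthogonal to [g x - x], so the pseudoreflection along it
    fixes them, in particular [v]. *)
Lemma isotropy_move (g : GL V) (x : V) :
    g \in isoms beta -> g v = v -> beta x (g x - x) != 0 ->
  exists s : GL V, [/\ s \in H, s (g x) = x & forall e, g e = e -> s e = e].
Proof.
move=> /isomsP gG gv nz.
have fixg e : g e = e -> beta e (g x - x) = 0.
  by move=> ge; rewrite formDr formNr -{1}ge gG subrr.
have [|||s [sH sgx sE]] := @reflection_move x (g x).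
- by rewrite gG.
- apply: contraNneq nz => e0; rewrite formDr formNr subr_eq0.
  (* Here [beta (g x) x = beta x x]; applying [betaC] to both sides gives [beta x (g x) = beta x x],
     against [nz]. *)
  move/eqP: e0; rewrite formDr formNr gG subr_eq0 => /eqP e.
  by rewrite betaC -e -betaC.
- exact: fixg.
by exists s; split=> // e /fixg/sE.
Qed.

(** An invertible rank one map along a vector of the radical is an isometry whatever its functional,
    so [rank1_move] applies with the fixed space of [g] as [A]. *)
Lemma isotropy_move_radical (g : GL V) (x : V) :
    g v = v -> g x != x -> g x - x \in radical beta ->
  exists s : GL V, [/\ s \in H, s (g x) = x & forall e, g e = e -> s e = e].
Proof.
move=> gv gx gxW.
have xE : x \notin fixedSpace g by apply/fixedSpaceP/eqP.
have gxE : g x \notin fixedSpace g.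
  apply: contra xE => /fixedSpaceP e; apply/fixedSpaceP.
  exact: (lker0P (lkerGL g)).
have [s [sE sgx [phi es]]] := rank1_move gxE xE.
have fixs e : g e = e -> s e = e by move=> ge; apply/sE/fixedSpaceP.
exists s; split=> //.
apply: (rank1_gen_reflections es); last exact: fixs.
apply: isoms_mod_radical => u; rewrite es rank1E addrC addKr.
by rewrite rpredZ // -opprB rpredN.
Qed.

(** Then [h * g] has a strictly larger fixed space than [g]. *)
Definition improvable (g : GL V) := exists2 h, h \in H &
  (forall e, g e = e -> h (g e) = e) /\ exists2 x, g x != x & h (g x) = x.

(** Induction on the codimension of the fixed space: passing from [g] to [h * g] does not affect
    membership in [H]. *)
Lemma gen_reflections_improvable (g : GL V) :
  (forall g', g' \in isoms beta -> g' v = v -> g' \notin H ->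
    ~ improvable g' -> False) ->
  g \in isoms beta -> g v = v -> g \in H.
Proof.
move=> imp; have [k] := ubnP (\dim {:V} - \dim (fixedSpace g)).
elim: k g => // k IH g; rewrite ltnS => lek gG gv.
apply: contraT => gH; exfalso; apply: (imp g gG gv gH) => -[h hH [hE [x gx hx]]].
case/negP: gH.
suff hg : (h * g)%g \in H by rewrite -(groupMl g hH).
have ltE : (\dim (fixedSpace g) < \dim (fixedSpace (h * g)%g))%N.
  rewrite ltn_neqAle -andbC dimvS /=; last first.
    apply/subvP=> e /fixedSpaceP ge; apply/fixedSpaceP.
    by rewrite GLME hE.
  apply: contra_neqN gx => /eqP eqd; apply/fixedSpaceP.
  have /eqP-> : fixedSpace g == fixedSpace (h * g)%g.
    rewrite eqEdim eqd leqnn andbT; apply/subvP=> e /fixedSpaceP ge.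
    by apply/fixedSpaceP; rewrite GLME hE.
  by apply/fixedSpaceP; rewrite GLME.
apply: IH.
- apply: leq_trans lek; rewrite ltn_sub2l //.
  by apply: leq_trans ltE _; rewrite dimvS ?subvf.
- by rewrite groupM // (subsetP gen_reflections_sub).
by rewrite GLME gv gen_reflections_fix.
Qed.

Lemma move_improvable (g : GL V) (x : V) : g x != x ->
  (exists s : GL V, [/\ s \in H, s (g x) = x & forall e, g e = e -> s e = e]) ->
  improvable g.
Proof.
move=> gx [s [sH sgx sE]]; exists s => //; split; last by exists x.
by move=> e ge; rewrite ge sE.
Qed.

(** * Siegel transformations of symmetric forms in odd characteristic *)

Section Siegel.
Hypotheses (thetaE : theta =1 id) (sym : forall u w, beta u w = beta w u).
Hypothesis two_neq0 : (2%:R : F) != 0.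

Lemma orthogonal_reflection d : beta d d != 0 -> beta v d = 0 ->
  exists2 r : GL V, r \in H
    & forall z, r z = z - (2%:R * beta z d / beta d d) *: d.
Proof.
move=> nz vd; pose phi := (- (2%:R / beta d d) *: form_hom d)%VF.
have phiE u : phi u = - (2%:R * beta u d / beta d d).
  by rewrite [LHS]scaled_form_homE; ring.
have k0 : 1 + phi d != 0.
  have -> : 1 + phi d = - 1 by rewrite phiE; field.
  by rewrite oppr_eq0 oner_eq0.
have rE z : GLelt (lker_rank1 k0) z = z - (2%:R * beta z d / beta d d) *: d.
  by rewrite /= rank1E phiE scaleNr.
exists (GLelt (lker_rank1 k0)) => //.
apply: (rank1_gen_reflections (phi := phi) (w := d)) => //.
  by apply/isomsP=> u w; rewrite !rE !formE !thetaE [beta d w]sym; field.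
by rewrite rE vd mulr0 mul0r scale0r subr0.
Qed.

(** The product of the reflections along [d] and [d + (Q / 2) a], two vectors of the same norm
    [Q = beta d d]. The coefficient [Q / 2] makes the factor of [a] exactly [beta z d]. *)
Lemma siegel_anisotropic a d :
    beta a a = 0 -> beta d a = 0 -> beta v a = 0 -> beta v d = 0 ->
    beta d d != 0 ->
  exists2 h, h \in H & forall z, beta z a = 0 -> h z = z + beta z d *: a.
Proof.
move=> aa da va vd nz; set Q := beta d d in nz *.
pose d' := d + (Q / 2%:R) *: a.
have d'd' : beta d' d' = Q.
  by rewrite !formE aa da (sym a) da -/Q !mulr0 !addr0.
have [||r rH rE] := @orthogonal_reflection d; [by []|by []|].
have [||r' r'H r'E] := @orthogonal_reflection d'.
- by rewrite d'd'.
- by rewrite !formE vd va mulr0 addr0.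
exists (r' * r)%g; first by rewrite groupM.
move=> z za; rewrite GLME r'E d'd' rE -/Q.
have -> : beta (z - (2%:R * beta z d / Q) *: d) d' = - beta z d.
  by rewrite !formE za da -/Q !(mulr0, addr0) divfK //; ring.
rewrite -addrA; congr (_ + _); rewrite /d' scalerDr scalerA.
rewrite mulrN !mulNr !scaleNr opprB opprK addrC addrK.
by congr (_ *: _); field; rewrite two_neq0 nz.
Qed.

(* Siegel transformations are additive in [b], and [b] is a sum of two *)
(* anisotropic vectors orthogonal to [a] and [v].                      *)
Lemma siegel_isotropic a b y :
    beta a a = 0 -> beta b b = 0 -> beta b a = 0 ->
    beta v a = 0 -> beta v b = 0 ->
    beta y a = 0 -> beta v y = 0 -> beta y b = 1 ->
  exists2 h, h \in H & forall z, beta z a = 0 -> h z = z + beta z b *: a.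
Proof.
move=> aa bb ba va vb ya vy yb.
(* The coefficient solves [beta d d = 1], since [beta y b = 1] and [beta b b = 0]. Then [b - d] has
   norm [-1], and [b = d + (b - d)]. *)
pose d := y + ((1 - beta y y) / 2%:R) *: b.
have dd : beta d d = 1.
  by rewrite /d !formE !thetaE bb yb (sym b y) yb; field.
have db : beta d b = 1 by rewrite /d !formE bb yb mulr0 addr0.
have da : beta d a = 0 by rewrite /d !formE ba ya mulr0 addr0.
have vd : beta v d = 0 by rewrite /d !formE vb vy mulr0 addr0.
clearbody d.
have [|h hH hE] := siegel_anisotropic aa da va vd.
  by rewrite dd oner_eq0.
have [||||h' h'H h'E] := @siegel_anisotropic a (b - d) aa.
- by rewrite !formE ba da subr0.
- by [].
- by rewrite !formE vb vd subr0.
- have -> : beta (b - d) (b - d) = - 1.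
    by rewrite !formE bb dd (sym b d) db; ring.
  by rewrite oppr_eq0 oner_eq0.
exists (h' * h)%g; first by rewrite groupM.
move=> z za; rewrite GLME hE // h'E; last by rewrite !formE aa za mulr0 addr0.
have -> : beta (z + beta z d *: a) (b - d) = beta z b - beta z d.
  by rewrite !formE (sym a b) (sym a d) ba da !(mulr0, subr0, addr0).
by rewrite -addrA -scalerDl addrCA subrr addr0.
Qed.
End Siegel.

(** * Isometries outside [H] that no element of [H] improves *)

Section Stuck.
Variable g : GL V.
Hypotheses (gG : g \in isoms beta) (gv : g v = v).
Hypothesis gH : g \notin H.
Hypothesis stuck : ~ improvable g.

Let N x := g x - x.

Lemma stuck_form x : beta x (N x) = 0.
Proof.
apply/eqP; apply: contraT => nz; case: stuck.
apply: (@move_improvable g x); last exact: isotropy_move.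
by apply: contraNneq nz => e; rewrite /N e subrr form0r.
Qed.

Lemma stuck_radical x : N x \in radical beta -> g x = x.
Proof.
move=> NW; apply/eqP; apply: contraT => gx; case: stuck.
exact: (@move_improvable g x gx (isotropy_move_radical gv gx NW)).
Qed.

(** Polarisation of [stuck_form]. *)
Lemma stuck_skew x y : beta x (N y) = - beta y (N x).
Proof.
have := stuck_form (x + y).
have -> : N (x + y) = N x + N y by rewrite /N linearD opprD addrACA.
rewrite formDl !(formDr _ (N x)) !stuck_form.
by rewrite add0r addr0 => /eqP; rewrite addr_eq0 => /eqP.
Qed.

Lemma stuck_fix e x : g e = e -> beta e (N x) = 0.
Proof.
by move=> ge; rewrite formDr formNr -{1}ge (isomsP _ _ gG) subrr.
Qed.

Lemma stuck_isotropic x : beta (N x) (N x) = 0.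
Proof.
have := stuck_form x; rewrite formDr formNr => /eqP; rewrite subr_eq0 => /eqP e.
have e' : beta (g x) x = beta x x by rewrite betaC e -betaC.
by rewrite formDl !formDr !formNl !formNr (isomsP _ _ gG) e e'; ring.
Qed.

Lemma stuck_moved : exists x, g x != x.
Proof.
have : g != 1%g by apply: contraNneq gH => ->.
move=> g1; have /existsP[x gx] : [exists x : finvect_type V, g x != x].
  apply: contraNT g1 => /existsPn H1; apply/eqP/val_inj/lfunP=> x /=.
  by rewrite id_lfunE; have /negbNE/eqP := H1 x.
by exists x.
Qed.

(** If all [beta x (N y)] vanish, [stuck_skew] puts [N x] in the radical, and [x] is fixed by
    [stuck_radical]. *)
Lemma stuck_nondegenerate x : g x != x -> exists y, beta x (N y) != 0.
Proof.
move=> gx; have /existsP[y] : [exists y : finvect_type V, beta x (N y) != 0].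
  apply: contraNT gx => /existsPn H1; apply/eqP/stuck_radical.
  apply/(radicalP _ linear_left) => y; apply/eqP; rewrite form_eq0C.
  by rewrite stuck_skew oppr_eq0; have /negbNE := H1 y.
by exists y.
Qed.

(** In [stuck_skew] the left side is linear in [x] and the right side [theta]-semilinear, so a
    nonzero value forces [theta c = c]. *)
Lemma stuck_hermitian : theta =1 id.
Proof.
have [x /stuck_nondegenerate [y nz]] := stuck_moved.
move=> c; have := stuck_skew (c *: x) y.
have -> : N (c *: x) = c *: N x by rewrite /N linearZ scalerBr.
rewrite formZl formZr [beta y _](_ : _ = - beta x (N y)); last first.
  by rewrite stuck_skew.
by rewrite mulrN opprK => /(mulIf nz).
Qed.

(** Let [t] be the transvection along [a = N y]; it fixes whatever [g] fixes. Then
    [beta x (t (g x) - x) = - (beta x a) ^+ 2] is nonzero, so [isotropy_move] gives [s] sending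
    [t (g x)] back to [x], and [s * t] improves [g]. *)
Lemma stuck_skewsymmetric : ~ (forall u w, beta u w = - beta w u).
Proof.
move=> skew; have [x gx] := stuck_moved; have [y nz] := stuck_nondegenerate gx.
have thid := stuck_hermitian.
set a := N y in nz *.
have aa : beta a a = 0 by apply: stuck_isotropic.
have fixa e : g e = e -> beta e a = 0 by apply: stuck_fix.
have gxa : beta (g x) a = - beta x a.
  rewrite -[RHS]/(- beta x (N y)) stuck_skew opprK.
  rewrite /a formDr formNr (isomsP _ _ gG).
  by rewrite [RHS]skew formDl formNl opprB.
clearbody a.
have k0 : 1 + form_hom a a != 0 by rewrite form_homE aa addr0 oner_eq0.
pose t := GLelt (lker_rank1 k0).
have tE z : t z = z + beta z a *: a by rewrite /= rank1E form_homE.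
have tfix e : g e = e -> t e = e.
  by move=> ge; rewrite tE fixa // scale0r addr0.
have tH : t \in H.
  apply: (rank1_gen_reflections (phi := form_hom a) (w := a)) => //.
    apply/isomsP=> u w; rewrite !tE !formE !thid aa.
    by rewrite [beta a w]skew; ring.
  exact: tfix.
have tG : t \in isoms beta by rewrite (subsetP gen_reflections_sub).
have [||| s [sH stgx sE]] := @isotropy_move (t * g)%g x.
- by rewrite groupM.
- by rewrite GLME gv tfix.
- have -> : (t * g)%g x - x = N x + beta (g x) a *: a by rewrite GLME tE addrAC.
  rewrite (formDr x (N x)) formZr thid stuck_form add0r.
  by rewrite gxa mulNr oppr_eq0 mulf_neq0.
case: stuck; exists (s * t)%g; first by rewrite groupM.
split=> [e ge|]; last by exists x; rewrite // GLME -[t _]GLME.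
by rewrite ge GLME [t e]tfix // sE // GLME ge tfix.
Qed.

(** The vectors [a = N x] and [b = N y] are isotropic, orthogonal to each other and to all vectors
    fixed by [g]. A Siegel transformation built from [a] and a multiple of [b] sends [g x = x + a]
    to [x]. *)
Lemma stuck_symmetric :
  (forall u w, beta u w = beta w u) -> (2%:R : F) != 0 -> False.
Proof.
move=> sym two_neq0; have thid := stuck_hermitian.
(* Aligning [N x] with [v] when [v] lies in the image of [N] modulo the    *)
(* radical makes [b] independent of [N x] and [v] modulo the radical.      *)
have [x gx hx] : exists2 x, g x != x &
    (forall z, beta z (N x) = 0 -> beta z v = 0) \/
    (forall u, ~ (forall z, beta z v = beta z (N u))).
  have [x0 gx0] := stuck_moved.
  have [/existsP[u /forallP Hu]|/existsPn Hu] := boolP [exists u : finvect_type V,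
      forall z : finvect_type V, beta z v == beta z (N u)].
    have [gu|gu] := eqVneq (g u) u.
      exists x0 => //; left=> z _; have /eqP-> := Hu z.
      by rewrite /N gu subrr form0r.
    by exists u => //; left=> z zu; have /eqP-> := Hu z.
  exists x0 => //; right=> u H1; have /negP[] := Hu u.
  by apply/forallP=> z; rewrite H1.
have [y nz] := stuck_nondegenerate gx.
(* Expanded, this is minus the sum of [beta u (N w)] and [beta w (N u)], which is zero by
   [stuck_skew]. *)
have NN u w : beta (N u) (N w) = 0.
  have := stuck_skew u w; rewrite /N !formE (isomsP _ _ gG) (sym w u).
  rewrite [beta w _]sym => /eqP; rewrite -subr_eq0 => /eqP e.
  by rewrite -[RHS]oppr0 -e; ring.
pose a := N x; pose b := N y.
have aa : beta a a = 0 by apply: NN.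
have bb : beta b b = 0 by apply: NN.
have ba : beta b a = 0 by apply: NN.
have va : beta v a = 0 by apply: stuck_fix.
have vb : beta v b = 0 by apply: stuck_fix.
have xa : beta x a = 0 by apply: stuck_form.
have fixa e : g e = e -> beta e a = 0 by apply: stuck_fix.
have fixb e : g e = e -> beta e b = 0 by apply: stuck_fix.
have gxE : g x = x + a by rewrite addrC subrK.
(* If [b = c1 a + c2 v] modulo the radical, then [c2 != 0], because [beta x a = 0] and
   [beta x b != 0]; so [v] is in the image of [N] modulo the radical. *)
have hx' : (forall z, beta z a = 0 -> beta z v = 0) \/
    (forall c1 c2, ~ forall z, beta z b = c1 * beta z a + c2 * beta z v).
  case: hx => [|hx]; [by left | right=> c1 c2 H1].
  have [c0|c0] := eqVneq c2 0.
    by case/eqP: nz; rewrite H1 c0 xa mulr0 mul0r addr0.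
  apply: (hx (c2^-1 *: (y - c1 *: x))) => z.
  have -> : N (c2^-1 *: (y - c1 *: x)) = c2^-1 *: (b - c1 *: a).
    rewrite /N linearZ linearB linearZ /= -scalerBr; congr (_ *: _).
    rewrite (scalerBr c1) !opprB addrACA [RHS]addrACA; congr (_ + _).
    exact: addrC.
  rewrite formZr (formDr z b) formNr (formZr c1) !thid H1.
  by rewrite addrAC subrr add0r mulKf.
rewrite -/b in nz; clearbody a b.
(* Otherwise the functional of [b] would be a combination of those of [a] and [v], contradicting
   [hx'] or [beta x b != 0]. A multiple of [y'] is the auxiliary vector of [siegel_isotropic]. *)
have [y' [y'a y'v y'b]] : exists y', [/\ beta y' a = 0, beta y' v = 0 & beta y' b != 0].
  have [/existsP[y' /and3P[/eqP ? /eqP ? ?]]|/existsPn H1] :=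
    boolP [exists y' : finvect_type V,
      [&& beta y' a == 0, beta y' v == 0 & beta y' b != 0]].
    by exists y'.
  have sub z : beta z a = 0 -> beta z v = 0 -> beta z b = 0.
    by move=> za zv; have := H1 z; rewrite za zv !eqxx negbK => /eqP.
  case: hx' => [hx'|hx'].
    have [z|c Hc] := @ker_sub_scalar _ _ (form_hom a) (form_hom b).
      by rewrite !form_homE => za; apply: sub => //; apply: hx'.
    by case/eqP: nz; have := Hc x; rewrite !form_homE xa mulr0.
  have [z|c1 [c2 Hc]] := @ker_cap_sub_comb _ _ (form_hom a) (form_hom v) (form_hom b).
    by rewrite !form_homE; apply: sub.
  by case: (hx' c1 c2) => z; have := Hc z; rewrite !form_homE.
have gxa : beta (g x) a = 0 by rewrite gxE !formE xa aa addr0.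
have gxb : beta (g x) b = beta x b by rewrite gxE !formE (sym a) ba addr0.
(* Chosen so that [beta (g x) (c *: b) = -1]. *)
pose c := - (beta x b)^-1.
have c0 : c != 0 by rewrite oppr_eq0 invr_neq0.
have [||||||||h hH hE] :=
  @siegel_isotropic thid sym two_neq0 a (c *: b) ((c * beta y' b)^-1 *: y').
- by [].
- by rewrite !formE bb !mulr0.
- by rewrite !formE ba mulr0.
- by [].
- by rewrite !formE vb mulr0.
- by rewrite !formE y'a mulr0.
- by rewrite sym !formE y'v mulr0.
- by rewrite !formE !thid; field; rewrite c0 y'b.
case: stuck; exists h => //; split=> [e ge|].
  by rewrite ge hE ?fixa // !formE fixb // mulr0 scale0r addr0.
exists x => //; rewrite hE // formZr thid gxb /c mulNr mulVf // scaleN1r gxE addrK //.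
Qed.

End Stuck.

(** A stuck element forces [theta] to be the identity and the form not to be skew, so the form is
    symmetric; moreover [2 != 0], since otherwise symmetric forms are skew. *)
Lemma isotropy_reflection_group :
    ~ theta =1 id \/ (forall u w, beta u w = - beta w u) \/
      (forall u w, beta u w = beta w u) ->
  reflection_group (isotropy (isoms beta) v).
Proof.
move=> type; exists isotropy_reflections.
  by move=> s; rewrite inE => /andP[].
apply/setP=> g; apply/idP/idP; last first.
  move=> gH; rewrite inE (subsetP gen_reflections_sub) //=.
  by rewrite gen_reflections_fix.
rewrite inE => /andP[gG /eqP gv].
apply: gen_reflections_improvable gG gv => {}g gG gv gH stuck.
have thid := stuck_hermitian gG gv gH stuck.
have skew := stuck_skewsymmetric gG gv gH stuck.
case: type => [//|[//|sym]].
apply: (stuck_symmetric gG gv gH stuck sym).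
apply: contra_notN skew => /eqP two0 u w; apply/eqP.
by rewrite -addr_eq0 [beta w u]sym -mulr2n -mulr_natl two0 mul0r.
Qed.
End Reflexive.

(** * Dickson polynomials and separation modulo the radical *)

Section Linearized.
Variables (F : finFieldType) (K : fieldType) (iota : {rmorphism F -> K}).
Local Notation q := #|F|.

Lemma card_pchar_nat (R : nzRingType) (f : {rmorphism F -> R}) : [pchar R].-nat q.
Proof.
have [p p_pr pF] := finPcharP F.
have /abelem_pgroup := fin_ring_pchar_abelem pF.
rewrite /pgroup cardsT; apply: sub_in_pnat => r _ /eqnP ->.
exact: rmorph_pchar pF.
Qed.

Lemma exprD_cardX (R : comNzRingType) (f : {rmorphism F -> R}) i (x y : R) :
  (x + y) ^+ (q ^ i) = x ^+ (q ^ i) + y ^+ (q ^ i).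
Proof. by apply: exprDn_pchar; rewrite pnatX (card_pchar_nat f). Qed.

(** These are the [q]-polynomials, whose evaluation is [F]-linear. *)
Definition linearized (P : {poly K}) := forall k, P`_k != 0 -> exists i, k = (q ^ i)%N.

Let iotaP : {rmorphism F -> {poly K}} := (polyC \o iota)%FUN.

Lemma linearizedB P Q : linearized P -> linearized Q -> linearized (P - Q).
Proof.
move=> lP lQ k; rewrite coefB.
have [->|/lP//] := eqVneq P`_k 0; have [->|/lQ//] := eqVneq Q`_k 0.
by rewrite subrr eqxx.
Qed.

Lemma linearizedZ c P : linearized P -> linearized (c *: P).
Proof. by move=> lP k; rewrite coefZ mulf_eq0 negb_or => /andP[_ /lP]. Qed.

Lemma exprB_cardX (R : comNzRingType) (f : {rmorphism F -> R}) i (x y : R) :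
  (x - y) ^+ (q ^ i) = x ^+ (q ^ i) - y ^+ (q ^ i).
Proof. by apply/(addIr (y ^+ (q ^ i))); rewrite -(exprD_cardX f) !subrK. Qed.

Lemma expf_cardX i (c : F) : c ^+ (q ^ i) = c.
Proof. by elim: i => [|i IH]; rewrite ?expr1 // expnSr exprM IH expf_card. Qed.

Lemma linearized_pow P : linearized P -> linearized (P ^+ q).
Proof.
move=> lP k; rewrite -[P]coefK poly_def.
have q0 : (0 < q)%N := ltnW (finNzRing_gt1 F).
have powD : {morph (fun Q : {poly K} => Q ^+ q) : x y / x + y}.
  by move=> x y; rewrite -(expn1 q) (exprD_cardX iotaP).
have pow0 : (0 : {poly K}) ^+ q = 0.
  by rewrite expr0n gtn_eqF.
rewrite (big_morph _ powD pow0).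
under eq_bigr do rewrite exprZn -exprM.
rewrite coef_sumMXn => nz.
have [i /andP[/eqP <- Pi]] : exists i : 'I_(size P), (i * q == k)%N && (P`_i != 0).
  apply/existsP; apply: contraNT nz => /existsPn H; apply/eqP/big1 => i /eqP ik.
  by have := H i; rewrite ik eqxx negbK => /eqP->; rewrite expr0n gtn_eqF.
by have [j ->] := lP _ Pi; exists j.+1; rewrite expnSr.
Qed.

(** This is the [F]-linearity of [P]: raising to the power [q ^ i] is additive and fixes [F]. *)
Lemma linearized_shift P c z : linearized P ->
  P \Po ('X - (iota c * z)%:P) = P - (iota c * P.[z])%:P.
Proof.
move=> lP; rewrite comp_polyE horner_coef.
rewrite -[X in _ = X - _]coefK poly_def mulr_sumr raddf_sum -sumrB.
apply: eq_bigr => k _; have [->|nz] := eqVneq P`_k 0.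
  by rewrite !scale0r mul0r mulr0 subr0.
have [i ->] := lP _ nz.
rewrite (exprB_cardX iotaP) scalerBr; congr (_ - _).
rewrite -polyC_exp -mul_polyC -polyCM; congr _%:P.
by rewrite exprMn -rmorphXn expf_cardX mulrCA.
Qed.

(** For [z != 0], the identity [\prod_c (X - c) = X ^+ q - X] is taken at [z^-1 *: Y] and multiplied
    by [z ^+ q]. *)
Lemma prod_subr_scalars (Y : {poly K}) z :
  \prod_(c : F) (Y - (iota c * z)%:P) = Y ^+ q - z ^+ q.-1 *: Y.
Proof.
have q0 : (0 < q)%N := ltnW (finNzRing_gt1 F).
have [->|z0] := eqVneq z 0.
  under eq_bigr do rewrite mulr0 subr0.
  rewrite prodr_const expr0n -subn1 subn_eq0 leqNgt finNzRing_gt1 scale0r subr0.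
  by rewrite cardT -cardE.
have /(congr1 (fun P => map_poly iota P \Po (z^-1 *: Y))) := finField_genPoly F.
rewrite rmorphB rmorphXn /= map_polyX !rmorph_prod comp_polyB.
rewrite comp_Xn_poly comp_polyX => H.
transitivity (z ^+ q *: ((z^-1 *: Y) ^+ q - z^-1 *: Y)).
  have -> : z ^+ q = \prod_(c : F) z by rewrite prodr_const.
  rewrite {}H -scaler_prod; apply: eq_bigr => c _.
  rewrite rmorphB /= map_polyX map_polyC comp_polyB comp_polyX comp_polyC.
  rewrite scalerBr scalerA mulfV // scale1r; congr (_ - _).
  by rewrite -mul_polyC -polyCM mulrC.
rewrite scalerBr exprZn !scalerA -exprMn mulfV // expr1n scale1r.
suff -> : z ^+ q / z = z ^+ q.-1 by [].
by rewrite -{1}(prednK q0) exprSr mulfK.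
Qed.

Definition eval_form n (x : 'rV[K]_n) (a : 'rV[F]_n) : K :=
  \sum_i iota (a 0 i) * x 0 i.

(** The Dickson polynomial specialised at the point [x]. *)
Definition orbit_poly n (x : 'rV[K]_n) : {poly K} :=
  \prod_(a : 'rV[F]_n) ('X - (eval_form x a)%:P).

(** Induction on the number of coordinates. Let [P] be the polynomial of the last [n] coordinates
    and [z] the first one; by [linearized_shift], the product is that of [P - c P(z)] over [c] in
    [F]. *)
Lemma orbit_poly_linearized n (x : 'rV[K]_n) : linearized (orbit_poly x).
Proof.
elim: n x => [|n IH] x.
  rewrite /orbit_poly (eq_bigr (fun _ => 'X)) => [|a _]; last first.
    by rewrite /eval_form big_ord0 subr0.
  rewrite prodr_const card_mx muln0 expn0 expr1 => k; rewrite coefX.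
  by have [->|_] := eqVneq k 1%N; [exists 0%N | rewrite eqxx].
pose z := x 0 0; pose y : 'rV_n := \row_i x 0 (lift 0 i).
have -> : orbit_poly x = orbit_poly y ^+ q - (orbit_poly y).[z] ^+ q.-1 *: orbit_poly y.
  rewrite -prod_subr_scalars.
  pose h (p : F * 'rV[F]_n) : 'rV[F]_n.+1 :=
    \row_i oapp (fun j => p.2 0 j) p.1 (unlift 0 i).
  pose h' (a : 'rV[F]_n.+1) := (a 0 0, \row_j a 0 (lift 0 j)).
  have hK : cancel h h'.
    move=> [c a]; rewrite /h' mxE unlift_none /=; congr (_, _).
    by apply/rowP=> j; rewrite !mxE liftK.
  have h'K : cancel h' h.
    move=> a; apply/rowP=> j; rewrite !mxE.
    by case: unliftP => [k ->|->] //=; rewrite mxE.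
  rewrite /orbit_poly (reindex h) /=; last by exists h' => ? _.
  rewrite -(pair_bigA _ (fun c a => 'X - (eval_form x (h (c, a)))%:P)) /=.
  apply: eq_bigr => c _; rewrite -linearized_shift; last exact: IH.
  rewrite /orbit_poly rmorph_prod; apply: eq_bigr => a _ /=.
  rewrite comp_polyB comp_polyX comp_polyC -addrA -opprD -polyCD; congr (_ - _%:P).
  rewrite /eval_form big_ord_recl mxE unlift_none /=; congr (_ + _).
  by apply: eq_bigr => j _; rewrite !mxE liftK.
by apply: linearizedB; [apply/linearized_pow/IH | apply/linearizedZ/IH].
Qed.

Lemma eval_formP n (x : 'rV[K]_n) c a b :
  eval_form x (c *: a + b) = iota c * eval_form x a + eval_form x b.
Proof.
rewrite /eval_form mulr_sumr -big_split; apply: eq_bigr => i _ /=.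
by rewrite !mxE rmorphD rmorphM mulrDl mulrA.
Qed.

Lemma size_prod_XsubC_fin (T : finType) (f : T -> K) :
  size (\prod_(t : T) ('X - (f t)%:P)) = #|T|.+1.
Proof. by rewrite -big_enum size_prod_XsubC -cardE. Qed.

Lemma orbit_poly_coef_max n (x : 'rV[K]_n) i :
  (n <= i)%N -> (orbit_poly x)`_(q ^ i) = (i == n)%:R.
Proof.
have sz : size (orbit_poly x) = (q ^ n).+1.
  by rewrite size_prod_XsubC_fin card_mx mul1n.
have /monicP := monic_prod_XsubC (index_enum 'rV[F]_n) predT (eval_form x).
rewrite -/(orbit_poly x) /lead_coef sz /= => lc.
rewrite leq_eqVlt => /predU1P[<-|ni]; first by rewrite lc eqxx.
by rewrite nth_default ?gtn_eqF // sz ltn_exp2l // finNzRing_gt1.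
Qed.

(* Both polynomials are divisible by [\prod_c ('X - eval_form x (c *m B))], *)
(* whose degree [q ^ n] exceeds that of their difference.                   *)
Lemma orbit_poly_eq n N (B : 'M[F]_(n, N)) (x y : 'rV[K]_N) : row_free B ->
    (forall c, eval_form x (c *m B) = eval_form y (c *m B)) ->
    (forall i, (n <= i < N)%N ->
      (orbit_poly x)`_(q ^ i) = (orbit_poly y)`_(q ^ i)) ->
  orbit_poly x = orbit_poly y.
Proof.
move=> freeB exy coefxy; apply/eqP; rewrite -subr_eq0; apply: contraT => nz.
have injB : injective (fun c : 'rV[F]_n => c *m B) by apply: row_free_inj.
pose R z := \prod_(c : 'rV[F]_n) ('X - (eval_form z (c *m B))%:P).
have RD z : R z %| orbit_poly z.
  rewrite /orbit_poly (bigID (mem [set c *m B | c : 'rV[F]_n])) /=.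
  rewrite big_imset /=; last by move=> ? ? _ _; apply: injB.
  exact: dvdp_mulIl.
have Rxy : R x = R y by apply: eq_bigr => c _; rewrite exy.
have : R x %| orbit_poly x - orbit_poly y by rewrite dvdp_sub ?RD // Rxy RD.
move/(dvdp_leq nz); rewrite size_prod_XsubC_fin card_mx mul1n leqNgt.
case/negP; rewrite ltnS; apply/leq_sizeP => k lek; apply/eqP; apply: contraT => ck.
have [i ki] := linearizedB (@orbit_poly_linearized _ x) (@orbit_poly_linearized _ y) ck.
subst k; rewrite leq_exp2l ?finNzRing_gt1 // in lek.
rewrite -(negPf ck) coefB subr_eq0.
(* For [i >= N] the coefficients are known, as both polynomials are monic of degree [q ^ N]. *)
have [iN|Ni] := ltnP i N; first by rewrite coefxy ?eqxx ?lek.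
by rewrite !orbit_poly_coef_max ?eqxx.
Qed.

(** The values at [x] of the linear forms over [F], with multiplicity, are the roots of
    [orbit_poly x]. *)
Lemma orbit_poly_fibers N (x y : 'rV[K]_N) t : orbit_poly x = orbit_poly y ->
  #|[set a | eval_form x a == t]| = #|[set a | eval_form y a == t]|.
Proof.
move=> exy.
have /prod_XsubC_eq/seq.permP/(_ (pred1 t)) :
    \prod_(s <- [seq eval_form x a | a <- enum {: 'rV[F]_N}]) ('X - s%:P) =
    \prod_(s <- [seq eval_form y a | a <- enum {: 'rV[F]_N}]) ('X - s%:P).
  by rewrite big_map [in RHS]big_map !big_enum.
rewrite count_map (count_map (eval_form y)) -!sum1_count.
by rewrite !big_enum_cond /= !sum1dep_card.
Qed.
End Linearized.

(** * Automorphisms carrying one evaluation map to another *)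

Section Extend.
Variables (F : finFieldType) (K : fieldType) (iota : {rmorphism F -> K}).
Variables (X : vectType F) (e1 e2 : X -> K).
Hypothesis e1P : forall c u w, e1 (c *: u + w) = iota c * e1 u + e1 w.
Hypothesis e2P : forall c u w, e2 (c *: u + w) = iota c * e2 u + e2 w.
Hypothesis fibers : forall t,
  #|[set a : finvect_type X | e1 a == t]| = #|[set a : finvect_type X | e2 a == t]|.

Lemma fiber_move (U : {vspace X}) : {in U, e1 =1 e2} ->
  exists2 g : GL X, {in U, forall u, g u = u} & forall a, e1 (g a) = e2 a.
Proof.
move=> eU.
suff [g gU gE] : exists2 g : GL X, {in U, forall u, g u = u} &
    {in (U + <<vbasis {:X}>>)%VS, forall a, e1 (g a) = e2 a}.
  exists g => // a; apply: gE; rewrite (span_basis (vbasisP _)).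
  by rewrite memvE (subv_trans (subvf _)) // addvSr.
elim: (vbasis {:X} : seq X) => [|z s [g gU gE]].
  by exists 1%g => [u|u]; rewrite ?span_nil ?addv0 => uU; rewrite GL1E ?eU.
pose A := (U + <<s>>)%VS.
have UA : {subset U <= A} by apply/subvP/addvSl.
have sub u : u \in (U + <<z :: s>>)%VS -> exists c, exists2 a, a \in A & u = c *: z + a.
  rewrite span_cons addvA (addvC U) -addvA => /memv_addP[_ /vlineP[c ->] [a aA ->]].
  by exists c, a.
have [zA|zA] := boolP (z \in A).
  exists g => // u /sub[c [a aA ->]]; apply: gE.
  by rewrite rpredD ?rpredZ.
(* If every [b] with [e1 (g b) = e2 z] lay in [A], these [b] would form a subset of the fiber of
   [e2] over [e2 z]. Both sets have the same size, so they would coincide and [z] would lie in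
   [A]. *)
have [b bA eb] : exists2 b, b \notin A & e1 (g b) = e2 z.
  have [/existsP[b /andP[bA /eqP eb]]|/existsPn H] :=
    boolP [exists b : finvect_type X, (b \notin A) && (e1 (g b) == e2 z)].
    by exists b.
  pose B1 := [set a : finvect_type X | e1 (g a) == e2 z].
  pose B2 := [set a : finvect_type X | e2 a == e2 z].
  have B1A a : a \in B1 -> a \in A.
    by rewrite inE => ea; have := H a; rewrite ea andbT negbK.
  have B12 : B1 \subset B2.
    by apply/subsetP=> a aB; rewrite inE -gE ?B1A //; rewrite inE in aB.
  have cB : #|B1| = #|B2|.
    rewrite -fibers; have <- : (g : finvect_type X -> finvect_type X) @^-1:
        [set a : finvect_type X | e1 a == e2 z] = B1.
      by apply/setP=> a; rewrite !inE.
    apply: card_preimset => u w; apply/(lker0P (lkerGL g)).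
  have /eqP eB : B1 == B2 by rewrite eqEcard B12 cB leqnn.
  by case/negP: zA; apply: B1A; rewrite eB inE.
have [h [hA hz _]] := rank1_move zA bA.
exists (g * h)%g => [u uU|u /sub[c [a aA ->]]]; rewrite GLME.
  by rewrite hA ?UA ?gU.
rewrite linearD linearZ /= hz (hA a aA).
by rewrite linearD linearZ /= e1P eb gE // e2P.
Qed.
End Extend.

(** * Linear substitutions and Dickson polynomials *)

Section LinearSubstitution.
Variable F : finFieldType.

Definition linear_poly N (a : 'rV[F]_N) : {mpoly F[N]} := \sum_j a 0 j *: 'X_j.

(** The columns of [A] give the images of the variables, so that evaluating the result at a row
    vector [x] is evaluating the original at [x *m A]. *)
Definition lin_subst n N (A : 'M[F]_(N, n)) : {mpoly F[n]} -> {mpoly F[N]} :=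
  comp_mpoly [tuple linear_poly (row i A^T) | i < n].

HB.instance Definition _ n N (A : 'M[F]_(N, n)) :=
  GRing.RMorphism.copy (lin_subst A) (comp_mpoly [tuple linear_poly (row i A^T) | i < n]).

Lemma lin_substZ n N (A : 'M[F]_(N, n)) c f :
  lin_subst A (c *: f) = c *: lin_subst A f.
Proof. exact: comp_mpolyZ. Qed.

Lemma lin_substX n N (A : 'M[F]_(N, n)) i :
  lin_subst A 'X_i = linear_poly (row i A^T).
Proof. by rewrite /lin_subst comp_mpolyXU -tnth_nth tnth_mktuple. Qed.

Lemma linear_polyP N c (a b : 'rV[F]_N) :
  linear_poly (c *: a + b) = c *: linear_poly a + linear_poly b.
Proof.
rewrite /linear_poly scaler_sumr -big_split; apply: eq_bigr => j _ /=.
by rewrite !mxE scalerDl scalerA.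
Qed.
HB.instance Definition _ N := GRing.isSemilinear.Build F 'rV[F]_N {mpoly F[N]} _
  (@linear_poly N) (GRing.semilinear_linear (@linear_polyP N)).

Lemma lin_subst_linear n N (A : 'M[F]_(N, n)) (a : 'rV[F]_n) :
  lin_subst A (linear_poly a) = linear_poly (a *m A^T).
Proof.
rewrite {1}/linear_poly rmorph_sum mulmx_sum_row linear_sum /=.
by apply: eq_bigr => i _; rewrite lin_substZ lin_substX linearZ.
Qed.

Lemma lin_substE n N (A : 'M[F]_(N, n)) f :
  lin_subst A f = \sum_(m <- msupp f) f@_m *: \prod_i lin_subst A 'X_i ^+ m i.
Proof.
rewrite {1}[f]mpolyE rmorph_sum /=; apply: eq_bigr => m _.
rewrite lin_substZ mpolyXE_id rmorph_prod /=; congr (_ *: _).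
by apply: eq_bigr => i _; rewrite rmorphXn.
Qed.

Lemma lin_subst_comp n N M (A : 'M[F]_(M, N)) (B : 'M[F]_(N, n)) f :
  lin_subst A (lin_subst B f) = lin_subst (A *m B) f.
Proof.
rewrite (lin_substE B) rmorph_sum [RHS]lin_substE /=; apply: eq_bigr => m _.
rewrite lin_substZ rmorph_prod /=; congr (_ *: _).
apply: eq_bigr => i _; rewrite rmorphXn /=; congr (_ ^+ _).
by rewrite !lin_substX lin_subst_linear trmx_mul row_mul.
Qed.

Lemma linear_poly_homog N (a : 'rV[F]_N) : linear_poly a \is 1.-homog.
Proof.
by apply: rpred_sum => j _; apply: dhomogZ; rewrite dhomogX /= mdeg1.
Qed.

Lemma dhomog_prod_fin N (I : finType) (P : pred I) (f : I -> {mpoly F[N]}) d :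
    (forall i, P i -> f i \is (d i).-homog) ->
  \prod_(i | P i) f i \is (\sum_(i | P i) d i).-homog.
Proof.
move=> fd; elim/big_rec2: _ => [|i p e Pi he]; first exact: dhomog1.
by apply: dhomogM => //; apply: fd.
Qed.

Lemma lin_subst_homog n N (A : 'M[F]_(N, n)) f :
  f \is homog mdeg -> lin_subst A f \is homog mdeg.
Proof.
case/homogP=> d /dhomogP fd; apply/homogP; exists d.
rewrite lin_substE big_seq; apply: rpred_sum => m /fd <-.
apply: dhomogZ; rewrite /= mdegE; apply: dhomog_prod_fin => i _.
by have := dhomogMn (m i) (linear_poly_homog (row i A^T)); rewrite mul1n lin_substX.
Qed.

Definition dickson_poly N : {poly {mpoly F[N]}} :=
  \prod_(a : 'rV[F]_N) ('X - (linear_poly a)%:P).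

(** The substitution permutes the linear forms, which are the roots. *)
Lemma lin_subst_dickson N (A : 'M[F]_N) k : A \in unitmx ->
  lin_subst A (dickson_poly N)`_k = (dickson_poly N)`_k.
Proof.
move=> uA; rewrite -coef_map /=; congr (polyseq _)`_k.
rewrite rmorph_prod /= [RHS](reindex_inj (h := fun a => a *m A^T)) /=.
  apply: eq_bigr => a _.
  by rewrite rmorphB /= map_polyX map_polyC /= lin_subst_linear.
by apply: can_inj (mulmxK _); rewrite unitmx_tr.
Qed.

Lemma dickson_coef_homog N k : (dickson_poly N)`_k \is homog mdeg.
Proof.
(* The truncated degree [size s - k] is harmless: for [k > size s] the coefficient is zero, which is
   homogeneous of every degree. *)
apply/homogP; rewrite /dickson_poly; move: (index_enum _) => s.
exists (size s - k)%N.
elim: s k => [|a s IH] k.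
  rewrite big_nil coef1 /=; case: eqP => _; [exact: dhomog1 | exact: dhomog0].
rewrite big_cons mulrBl coefB coefXM coefCM; apply: rpredB => /=.
  by case: k => [|k] /=; [exact: dhomog0 | exact: IH].
have [ks|sk] := leqP k (size s).
  by rewrite subSn // -(add1n (size s - k)) dhomogM ?linear_poly_homog ?IH.
rewrite nth_default ?mulr0 ?dhomog0 //.
by rewrite size_prod_XsubC.
Qed.

(** Up to sign, the coefficient of [X] in the Dickson polynomial. *)
Definition nonzero_linear_prod N : {mpoly F[N]} :=
  \prod_(a : 'rV[F]_N | a != 0) linear_poly a.

Lemma nonzero_linear_prod_homog N : nonzero_linear_prod N \is homog mdeg.
Proof.
apply: homogE; apply: dhomog_prod_fin => a _; exact: linear_poly_homog.
Qed.

Lemma nonzero_linear_prod_subst N (A : 'M[F]_N) : A \in unitmx ->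
  lin_subst A (nonzero_linear_prod N) = nonzero_linear_prod N.
Proof.
move=> uA; have uAT : A^T \in unitmx by rewrite unitmx_tr.
rewrite /nonzero_linear_prod rmorph_prod [RHS](reindex_inj (can_inj (mulmxK uAT))) /=.
apply: eq_big => [a|a _]; last by rewrite lin_subst_linear.
by rewrite -(inj_eq (can_inj (mulmxK uAT)) a 0) mul0mx.
Qed.

Lemma linear_poly_neq0 N (a : 'rV[F]_N) : a != 0 -> linear_poly a != 0.
Proof.
apply: contraNneq => a0; apply/eqP/rowP=> i; rewrite mxE.
have := mcoeff0 F U_(i)%MM; rewrite -a0 /linear_poly raddf_sum /=.
rewrite (bigD1 i) //= big1 => [|j /negPf ji]; rewrite mcoeffZ mcoeffXU ?ji ?mulr0 //.
by rewrite eqxx mulr1 addr0.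
Qed.

Lemma nonzero_linear_prod_neq0 N : nonzero_linear_prod N != 0.
Proof. by apply/prodf_neq0 => a; apply: linear_poly_neq0. Qed.

(** For [N > 0] the product is nonzero but vanishes at the origin, so none of its positive powers is
    [1]. *)
Lemma nonzero_linear_prodX_inj N :
  (0 < N)%N -> injective (fun i => nonzero_linear_prod N ^+ i).
Proof.
move=> N0; set Z := nonzero_linear_prod N.
suff lt i j : Z ^+ i = Z ^+ (i + j) -> j = 0%N.
  move=> i j; case: (leqP i j) => [/subnKC<- /lt-> | /ltnW/subnKC<- /esym/lt->];
    by rewrite addn0.
move=> eij; apply: contraTeq (oner_neq0 F) => j0; rewrite negbK.
have : Z ^+ j = 1.
  apply: (mulfI (x := Z ^+ i)); first by rewrite expf_neq0 ?nonzero_linear_prod_neq0.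
  by rewrite mulr1 -exprD.
move/(congr1 (meval (fun=> 0))); rewrite meval1 rmorphXn /= => <-.
have -> : meval (fun=> 0) Z = 0; last by rewrite expr0n (negPf j0).
rewrite rmorph_prod /=; apply/eqP/prodf_eq0.
exists (const_mx 1).
  apply/eqP=> /rowP/(_ (Ordinal N0)); rewrite !mxE => /eqP; exact/negP/oner_neq0.
apply/eqP; rewrite /linear_poly raddf_sum big1 //= => j' _.
by rewrite mevalZ mevalXU mulr0.
Qed.

End LinearSubstitution.

(** * Evaluation at points over an extension field *)

Section Evaluation.
Variables (F : finFieldType) (K : fieldType) (iota : {rmorphism F -> K}).

Definition poly_eval n (x : 'rV[K]_n) (f : {mpoly F[n]}) : K :=
  (map_mpoly iota f).@[fun i => x 0 i].

HB.instance Definition _ n (x : 'rV[K]_n) :=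
  GRing.RMorphism.copy (poly_eval x) (meval (fun i => x 0 i) \o map_mpoly iota).

Lemma poly_evalX n (x : 'rV[K]_n) i : poly_eval x 'X_i = x 0 i.
Proof. by rewrite /poly_eval map_mpolyX mevalXU. Qed.

Lemma poly_evalZ n (x : 'rV[K]_n) c f : poly_eval x (c *: f) = iota c * poly_eval x f.
Proof. by rewrite /poly_eval map_mpolyZ mevalZ. Qed.

Lemma poly_eval_linear n (x : 'rV[K]_n) a :
  poly_eval x (linear_poly a) = eval_form iota x a.
Proof.
rewrite /linear_poly rmorph_sum; apply: eq_bigr => i _ /=.
by rewrite poly_evalZ poly_evalX.
Qed.

Lemma eval_form_mulmx n N (A : 'M[F]_(N, n)) (x : 'rV[K]_N) (a : 'rV[F]_n) :
  eval_form iota x (a *m A^T) = eval_form iota (x *m map_mx iota A) a.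
Proof.
have E M (y : 'rV[K]_M) b : eval_form iota y b = (y *m (map_mx iota b)^T) 0 0.
  by rewrite mxE; apply: eq_bigr => i _; rewrite !mxE mulrC.
by rewrite !E map_mxM trmx_mul -map_trmx trmxK mulmxA.
Qed.

Lemma poly_eval_subst n N (A : 'M[F]_(N, n)) f (x : 'rV[K]_N) :
  poly_eval x (lin_subst A f) = poly_eval (x *m map_mx iota A) f.
Proof.
rewrite lin_substE [in RHS](mpolyE f) !rmorph_sum /=; apply: eq_bigr => m _.
rewrite !poly_evalZ mpolyXE_id !rmorph_prod /=; congr (_ * _).
apply: eq_bigr => i _; rewrite !rmorphXn /=; congr (_ ^+ _).
rewrite lin_substX poly_eval_linear poly_evalX rowE eval_form_mulmx.
rewrite /eval_form (bigD1 i) //= big1 => [|j /negPf ji].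
  by rewrite mxE !eqxx rmorph1 mul1r addr0.
by rewrite mxE ji andbF rmorph0 mul0r.
Qed.

Lemma poly_eval_dickson n (x : 'rV[K]_n) k :
  poly_eval x (dickson_poly F n)`_k = (orbit_poly iota x)`_k.
Proof.
rewrite -coef_map /=; congr (polyseq _)`_k.
rewrite rmorph_prod; apply: eq_bigr => a _.
by rewrite rmorphB /= map_polyX map_polyC /= poly_eval_linear.
Qed.
End Evaluation.

(** * Matrices of group elements and padding of separating sets *)

Section GLmatrix.
Variables (F : finFieldType) (U : vectType F).
Local Notation N := (\dim {:U}).

(** Matrices act on row vectors, which reverses the factors. *)
Lemma GLmxM (g h : GL U) : GLmx (g * h)%g = GLmx h *m GLmx g.
Proof. by rewrite /GLmx -mxof_comp // vbasisP. Qed.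

Lemma GLmx1 : GLmx (1%g : GL U) = 1%:M.
Proof. by apply: mxof1; apply: basis_free (vbasisP _). Qed.

Lemma GLmxV (g : GL U) : GLmx g^-1%g *m GLmx g = 1%:M.
Proof. by rewrite -GLmxM mulgV GLmx1. Qed.

Lemma GLmx_unit (g : GL U) : GLmx g \in unitmx.
Proof. by have /mulmx1_unit[] := GLmxV g. Qed.

Lemma poly_actE (g : GL U) f : poly_act g f = lin_subst (GLmx g^-1%g) f.
Proof.
congr (f \mPo _); apply: eq_mktuple => i.
by apply: eq_bigr => j _; rewrite !mxE.
Qed.

Variables (K : closedFieldType) (iota : {rmorphism F -> K}).

Lemma point_actM (g h : GL U) (x : 'rV[K]_N) :
  point_act iota (g * h)%g x = point_act iota g (point_act iota h x).
Proof. by rewrite /point_act GLmxM map_mxM mulmxA. Qed.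

(** Since [GL U] is finite, lying in one orbit is decidable, which makes the contrapositive of
    separation available. *)
Lemma nonseparated_same_orbit (G : {set GL U}) S x y :
    geometric_separating_set iota G S ->
    (forall f, f \in S -> poly_eval iota x f = poly_eval iota y f) ->
  same_orbit iota G x y.
Proof.
move=> [_ sepS] exy.
have [/existsP[g /andP[gG /eqP e]]|/existsPn H] :=
  boolP [exists g : GL U, (g \in G) && (y == point_act iota g x)].
  by exists g.
have [|f fS] := sepS x y; last by rewrite -[eval_at _ _ x]/(poly_eval _ _ _) exy // eqxx.
by case=> g gG e; have := H g; rewrite gG e eqxx.
Qed.

(* Powers of [nonzero_linear_prod] supply the missing invariants. *)
Lemma has_homog_geom_sep_set_pad (G : {set GL U}) S :
    (size S <= N)%N -> {in S, forall f, f \is homog mdeg} ->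
    geometric_separating_set iota G S ->
  has_homog_geom_sep_set iota G N.
Proof.
move=> leS homS [invS sepS].
have {S leS homS invS sepS} [S [uS leS homS [invS sepS]]] : exists S,
  [/\ uniq S, (size S <= N)%N, {in S, forall f, f \is homog mdeg}
    & geometric_separating_set iota G S].
  exists (undup S); split; rewrite ?undup_uniq //.
  - exact: leq_trans (size_undup S) leS.
  - by move=> f; rewrite mem_undup; apply: homS.
  split=> [f|x y /sepS[f]]; first by rewrite mem_undup; apply: invS.
  by exists f; rewrite ?mem_undup.
have [k] := ubnP (N - size S); elim: k S uS leS homS invS sepS => // k IH.
move=> S uS leS homS invS sepS lek.
have [eS|neS] := eqVneq (size S) N; first by exists S.
have ltS : (size S < N)%N by rewrite ltn_neqAle neS.
pose Z := nonzero_linear_prod F N.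
(* Among [size S + 1] distinct powers of [Z], one is outside [S]. *)
have [i Zi] : exists i, Z ^+ i \notin S.
  have [/allP sub|/allPn[_ /mapP[i _ ->]]] :=
    boolP (all (mem S) (mkseq (fun i => Z ^+ i) (size S).+1)); last by exists i.
  have /uniq_leq_size/(_ sub) : uniq (mkseq (fun i => Z ^+ i) (size S).+1).
    rewrite mkseq_uniq //; apply: nonzero_linear_prodX_inj.
    exact: leq_ltn_trans ltS.
  by rewrite size_mkseq ltnn.
apply: (IH (Z ^+ i :: S)) => //=.
- by rewrite Zi.
- move=> f; rewrite inE => /predU1P[->|/homS//].
  have /homogP[d Zd] := nonzero_linear_prod_homog F N.
  by apply/homogP; exists (d * i)%N; apply: dhomogMn.
- move=> f; rewrite inE => /predU1P[->|/invS//] g _.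
  by rewrite poly_actE rmorphXn /= nonzero_linear_prod_subst ?GLmx_unit.
- by move=> x y /sepS[f fS]; exists f; rewrite // inE fS orbT.
by rewrite -ltnS; apply: leq_trans lek; rewrite ltnS ltn_sub2l.
Qed.
End GLmatrix.

(** The two sides use two finite structures on ['rV[F]_N], as a vector space and as a matrix
    type. *)
Lemma card_finvect_rV (F : finFieldType) N (P : pred 'rV[F]_N) :
  #|[set a : finvect_type 'rV[F]_N | P a]| = #|[set a : 'rV[F]_N | P a]|.
Proof.
have inj : injective (fun a : finvect_type 'rV[F]_N => a : 'rV[F]_N) by [].
rewrite -(card_imset _ inj).
apply: eq_card => a; apply/imsetP/idP => [[b + ->]|]; rewrite !inE // => Pa.
by exists a; rewrite ?inE.
Qed.

(** * Separation modulo a stable subspace *)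

Section Quotient.
Variables (F : finFieldType) (K : closedFieldType) (iota : {rmorphism F -> K}).
Variables (V : vectType F) (W : {vspace V}) (G : {group GL V}).
Hypothesis stableW : forall g, g \in G -> {in W, forall u, g u \in W}.
Hypothesis unipotentW : forall g : GL V, (forall u, g u - u \in W) -> g \in G.

Local Notation N := (\dim {:V}).
Local Notation n := (\dim {:quotv W}).
Local Notation G2 := (quot_image W G).

Definition projmx : 'M[F]_(N, n) := mxof (vbasis {:V}) (vbasis {:quotv W}) (projq W).

Lemma dim_quotv : (\dim W + n = N)%N.
Proof. by rewrite -(limg_ker_dim (projq W) fullv) capfv lker_projq limg_projq. Qed.

(** The projection is onto; dually, forms on [V / W] embed into forms on [V]. *)
Lemma projmx_free : row_free projmx^T.
Proof.
apply/row_freeP; exists (mxof (vbasis {:quotv W}) (vbasis {:V}) (projq W)^-1)^T.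
rewrite -trmx_mul -mxof_comp ?vbasisP //.
have -> : (projq W \o (projq W)^-1)%VF = \1%VF.
  by apply/lfunP=> x; rewrite comp_lfunE id_lfunE limg_lfunVK // limg_projq memvf.
by rewrite mxof1 ?trmx1 // (basis_free (vbasisP _)).
Qed.

Lemma projq_eq0 u : (projq W u == 0) = (u \in W).
Proof. by rewrite -memv_ker lker_projq. Qed.

(** Here [(projq W)^-1] is a linear section. The induced map is compatible with the projections
    because [g] preserves [W], and injective because [g^-1] does. *)
Lemma quot_lift (g : GL V) : g \in G ->
  exists2 h : GL (quotv W), h \in G2 & (h \o projq W = projq W \o g)%VF.
Proof.
move=> gG; pose f := (projq W \o g \o (projq W)^-1)%VF.
have fE u : f (projq W u) = projq W (g u).
  rewrite !comp_lfunE; apply/eqP; rewrite -subr_eq0 -!linearB projq_eq0.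
  apply: stableW => //.
  by rewrite -projq_eq0 linearB /= limg_lfunVK ?subrr // memv_img ?memvf.
have kf : lker f == 0%VS.
  rewrite -subv0; apply/subvP=> x; rewrite memv_ker memv0.
  have /memv_imgP[u _ ->] : x \in limg (projq W) by rewrite limg_projq memvf.
  rewrite fE !projq_eq0 => gu; have := stableW (groupVr gG) gu.
  by rewrite -GLME mulVg GL1E.
have kfE : (GLelt kf \o projq W = projq W \o g)%VF.
  by apply/lfunP=> u; rewrite [LHS]comp_lfunE [RHS]comp_lfunE; apply: fE.
by exists (GLelt kf); rewrite // inE; apply/exists_inP; exists g => //; apply/eqP.
Qed.

Lemma GLmx_projmx (g : GL V) (h : GL (quotv W)) :
  (h \o projq W = projq W \o g)%VF -> GLmx g *m projmx = projmx *m GLmx h.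
Proof. by move=> e; rewrite -!mxof_comp ?vbasisP // e. Qed.

Lemma GLmxV_projmx (g : GL V) (h : GL (quotv W)) :
    GLmx g *m projmx = projmx *m GLmx h ->
  GLmx g^-1%g *m projmx = projmx *m GLmx h^-1%g.
Proof.
move=> e; rewrite -[LHS]mulmx1 -[1%:M](GLmxV h^-1%g) invgK -mulmxA.
by rewrite (mulmxA projmx) -e !mulmxA GLmxV mul1mx.
Qed.

Lemma unipotent_orbit (x y : 'rV[K]_N) :
    x *m map_mx iota projmx = y *m map_mx iota projmx ->
    (forall i, (n <= i < N)%N ->
      (orbit_poly iota x)`_(#|F| ^ i) = (orbit_poly iota y)`_(#|F| ^ i)) ->
  same_orbit iota G x y.
Proof.
move=> exy coefxy.
have exyB c : eval_form iota x (c *m projmx^T) = eval_form iota y (c *m projmx^T).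
  by rewrite !eval_form_mulmx exy.
have D := orbit_poly_eq projmx_free exyB coefxy.
(* The forms on [V] that come from [V / W]. *)
pose U := limg (linfun (mulmxr projmx^T : 'rV[F]_n -> 'rV[F]_N)).
have [||t|u|M MU ME] := @fiber_move _ _ iota 'rV[F]_N
  (eval_form iota x) (eval_form iota y) _ _ _ U.
- exact: eval_formP.
- exact: eval_formP.
- by rewrite !card_finvect_rV; apply: orbit_poly_fibers.
- by case/memv_imgP=> c _ ->; rewrite lfunE /= exyB.
(* [M] acts on coefficient vectors of linear forms; its transpose [T] acts on the points. *)
pose A := lin1_mx M; pose T := A^T.
have AE a : a *m A = M a by rewrite mul_rV_lin1.
have uT : T \in unitmx.
  rewrite unitmx_tr; have /mulmx1_unit[] // : A *m lin1_mx (M^-1)%g = 1%:M.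
  apply/row_matrixP=> i; rewrite !rowE mulmxA AE mul_rV_lin1 /= mulmx1.
  by rewrite lker0_lfunK ?lkerGL.
(* Fixing the forms that come from [V / W] means, dually, acting trivially on [V / W]. *)
have TP : T *m projmx = projmx.
  apply: trmx_inj; rewrite trmx_mul trmxK; apply/row_matrixP=> i.
  rewrite !rowE mulmxA AE MU //; apply/memv_imgP.
  by exists (delta_mx 0 i); rewrite ?memvf // lfunE.
pose g0 := hommx (vbasis {:V}) (vbasis {:V}) T.
have g0T : mxof (vbasis {:V}) (vbasis {:V}) g0 = T.
  by rewrite hommxK // vbasisP.
have kg : lker g0 == 0%VS.
  rewrite -subv0; apply/subvP=> u; rewrite memv_ker memv0.
  move/eqP=> gu0; rewrite -(rVof_eq0 (vbasisP {:V})).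
  rewrite -(inj_eq (can_inj (mulmxK uT))) mul0mx -g0T.
  by rewrite -rVof_app ?vbasisP // gu0 linear0.
pose g := GLelt kg.
have gT : GLmx g = T by [].
have pg : (projq W \o g = projq W)%VF.
  apply: (can_inj (mxofK (vbasisP _) (vbasisP _))).
  by rewrite (@mxof_comp _ _ _ _ _ (vbasis {:V})) ?vbasisP // g0T.
exists g.
  apply: unipotentW => u; rewrite -projq_eq0 linearB /= -[projq W (g u)]comp_lfunE.
  by rewrite pg subrr.
apply/rowP=> i; rewrite /point_act gT.
(* Coordinates are values of the basis forms, so the identity satisfied by [M] applies. *)
have E (z : 'rV[K]_N) : z 0 i = eval_form iota z (delta_mx 0 i).
  rewrite /eval_form (bigD1 i) //= big1 => [|j /negPf ji].
    by rewrite mxE !eqxx rmorph1 mul1r addr0.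
  by rewrite mxE ji andbF rmorph0 mul0r.
by rewrite !E -eval_form_mulmx trmxK AE ME.
Qed.

Lemma quotient_homog_geom_sep_set :
  has_homog_geom_sep_set iota G2 n -> has_homog_geom_sep_set iota G (\dim W + n).
Proof.
case=> S2 [uS2 sS2 homS2 sepS2]; rewrite dim_quotv.
pose dick i := (dickson_poly F N)`_(#|F| ^ i).
pose S := [seq lin_subst projmx f | f <- S2] ++ [seq dick i | i <- index_iota n N].
apply: (@has_homog_geom_sep_set_pad _ _ _ _ _ S).
- by rewrite size_cat !size_map sS2 size_iota subnKC // -dim_quotv leq_addl.
- move=> f; rewrite mem_cat => /orP[] /mapP[f' f'S ->].
    by apply: lin_subst_homog; apply: homS2.
  exact: dickson_coef_homog.
split=> [f|x y nxy].
  rewrite mem_cat => /orP[] /mapP[f' f'S ->] g gG; last first.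
    by rewrite poly_actE lin_subst_dickson ?GLmx_unit.
  have [h hG2 gh] := quot_lift gG; rewrite poly_actE lin_subst_comp.
  rewrite (GLmxV_projmx (GLmx_projmx gh)) -lin_subst_comp -poly_actE.
  by rewrite sepS2.1.
have [/hasP[f fS nf]|/hasPn eS] :=
  boolP (has (fun f => poly_eval iota x f != poly_eval iota y f) S); first by exists f.
have {}eS f : f \in S -> poly_eval iota x f = poly_eval iota y f.
  by move/eS; rewrite negbK => /eqP.
case: nxy.
(* The pullbacks put the images of [x] and [y] in one [G2]-orbit. A lift [g] makes [g x] and [y]
   agree modulo [W], and the Dickson coefficients, invariant under all of [GL V], still agree at
   these two points. *)
have [|h] := @nonseparated_same_orbit _ _ _ iota G2 S2
  (x *m map_mx iota projmx) (y *m map_mx iota projmx) sepS2.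
  move=> f fS; rewrite -!poly_eval_subst; apply: eS.
  by rewrite mem_cat map_f.
rewrite inE => /exists_inP[g gG /eqP gh] eyx.
have [|i iN|g' g'G ->] := @unipotent_orbit (point_act iota g x) y.
- rewrite eyx /point_act -!mulmxA; congr (_ *m _).
  by rewrite -!map_mxM (GLmx_projmx gh).
- rewrite -!poly_eval_dickson -poly_eval_subst lin_subst_dickson ?GLmx_unit //.
  by apply: (eS (dick i)); rewrite mem_cat orbC (map_f dick) // mem_index_iota.
by exists (g' * g)%g; rewrite ?groupM ?point_actM.
Qed.
End Quotient.

(** The pairs [(theta, eps)] are [(id, -1)], [(id, 1)] and [(theta, 1)] for alternating, symmetric
    and Hermitian forms. *)
Lemma form_reflexive (F : finFieldType) (V : vectType F) (beta : V -> V -> F) :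
    alternating_form beta \/ symm_form beta \/ hermitian_form beta ->
  exists (theta : {rmorphism F -> F}) (eps : F),
    [/\ forall w, linear_for *%R (beta^~ w),
        forall u, linear_for (theta \; *%R) (beta u),
        eps != 0, forall u w, beta u w = eps * theta (beta w u)
      & ~ theta =1 id \/ (forall u w, beta u w = - beta w u) \/
          (forall u w, beta u w = beta w u)].
Proof.
have id1 (b : V -> V -> F) : bilinear_for *%R *%R b ->
  forall u, linear_for ((idfun : {rmorphism F -> F}) \; *%R) (b u).
  by case=> _ + u c x y => ->.
case=> [[bil alt]|[[bil sym]|[theta [thetaK nid bil sym]]]].
- have skew u w : beta u w = - beta w u.
    have := alt (u + w); rewrite (formDl bil.1) !(formDr (id1 _ bil)).
    by rewrite !alt add0r addr0 => /eqP; rewrite addr_eq0 => /eqP.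
  exists (idfun : {rmorphism F -> F}), (-1); split.
  + exact: bil.1.
  + exact: id1.
  + by rewrite oppr_eq0 oner_eq0.
  + by move=> u w; rewrite mulN1r.
  + by right; left.
- exists (idfun : {rmorphism F -> F}), 1; split.
  + exact: bil.1.
  + exact: id1.
  + exact: oner_neq0.
  + by move=> u w; rewrite mul1r.
  + by right; right.
exists theta, 1; split.
+ exact: bil.1.
+ exact: bil.2.
+ exact: oner_neq0.
+ by move=> u w; rewrite mul1r.
by left.
Qed.

Theorem theorem6p3 (F : finFieldType) (Fbar : closedFieldType)
    (iota : {rmorphism F -> Fbar}) (Fbar_alg : integralRange iota)
    (V : vectType F) (beta : V -> V -> F)
    (beta_form : alternating_form beta \/ symm_form beta \/ hermitian_form beta) :
  let G := isoms beta in
  let W1 := radical beta in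
  let G2 := quot_image W1 G in
  let m := \dim W1 in
  let n := \dim {:quotv W1} in
  has_homog_geom_sep_set iota G2 n ->
  has_homog_geom_sep_set iota G (m + n) /\ rigid_reflection_group G.
Proof.
move=> G W1 G2 m n sep.
have [theta [eps [lin_l lin_r eps0 betaC type]]] := form_reflexive beta_form.
split; last by move=> v; apply: (isotropy_reflection_group lin_l lin_r eps0 betaC).
apply: (@quotient_homog_geom_sep_set _ _ _ _ _ (isoms_group beta)) sep => [g gG u|g].
  (* Isometries preserve the radical, as [beta (g u) w = beta u (g^-1 w)]. *)
  move/(radicalP _ lin_l) => uW; apply/(radicalP _ lin_l) => w.
  by rewrite -(isomsP _ _ (groupVr gG)) -GLME mulVg GL1E uW.
exact: (isoms_mod_radical lin_l lin_r eps0 betaC).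
Qed.
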